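(* Let $(A,\cdot,\circ)$ be a cocommutative Hopf brace over a field $k$. Then the linear map $c:A\otimes A\to A\otimes A$ given by $$c(x\otimes y)=(x_1\rightharpoonup y_1)\otimes(x_2\leftharpoonup y_2),\qquad x,y\in A,$$ is a coalgebra isomorphism and a solution of the braid equation $$(c\otimes\mathrm{id})(\mathrm{id}\otimes c)(c\otimes\mathrm{id})=(\mathrm{id}\otimes c)(c\otimes\mathrm{id})(\mathrm{id}\otimes c).$$
   Context: Sweedler notation $\Delta(a)=a_1\otimes a_2$ (summation understood) is used. A Hopf brace $(A,\cdot,\circ)$ is a coalgebra $(A,\Delta,\epsilon)$ together with two Hopf algebra structures $(A,\cdot,1,\Delta,\epsilon,S)$ and $(A,\circ,1_\circ,\Delta,\epsilon,T)$ on it (write $ab=a\cdot b$) such that $a\circ(bc)=(a_1\circ b)S(a_2)(a_3\circ c)$ for all $a,b,c\in A$. (It follows that $1_\circ=1$.) It is called cocommutative if the underlying coalgebra is cocommutative. In a cocommutative Hopf brace put, for $a,b\in A$, $$a\rightharpoonup b=S(a_1)(a_2\circ b),\qquad a\leftharpoonup b=T(a_1\rightharpoonup b_1)\circ a_2\circ b_2 .$$ $A\otimes A$ carries the tensor product coalgebra structure. *)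

(* Defs.v *)
From HB Require Import structures.
From mathcomp Require Import all_boot all_order all_algebra.
From mathcomp Require Import boolp.

Set Implicit Arguments.
Unset Strict Implicit.
Unset Printing Implicit Defensive.

Import GRing.Theory.
Local Open Scope ring_scope.
Local Open Scope quotient_scope.

Reserved Notation "V ⊗ W" (at level 40, left associativity).
Reserved Notation "\sw_ ( x1 , x2 <- x ) E"
  (at level 41, x1 name, x2 name, x at level 99, E at level 41,
   format "'[' \sw_ ( x1 ,  x2  <-  x ) '/  '  E ']'").
Reserved Notation "a *[ H ] b"
  (at level 40, left associativity, format "a  *[ H ]  b").
Reserved Notation "a ⇀ b" (at level 40, left associativity).
Reserved Notation "a ↼ b" (at level 40, left associativity).

(** * Tensor product of two [k]-modules

A list [[:: (v1, w1); ..; (vn, wn)]] stands for the finite sum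
[v1 ⊗ w1 + .. + vn ⊗ wn]; no separate scalars are needed, as they can be
absorbed in the left factors. [V ⊗ W] is the quotient of these formal sums by
the least congruence that makes [(v, w)] bilinear; its universal property is
proved in [tliftE], [tlift_linear] and [tensor_ext]. *)

Section TensorCongruence.
Context (k : fieldType) (V W : lmodType k).

Inductive tensor_cong : seq (V * W) -> seq (V * W) -> Prop :=
| tensor_refl (s : seq (V * W)) : tensor_cong s s
| tensor_sym s t : tensor_cong s t -> tensor_cong t s
| tensor_trans s t u : tensor_cong s t -> tensor_cong t u -> tensor_cong s u
| tensor_cat s s' t t' : tensor_cong s s' -> tensor_cong t t' ->
    tensor_cong (s ++ t) (s' ++ t')
| tensor_catC s t : tensor_cong (s ++ t) (t ++ s)
| tensor_zero w : tensor_cong [:: (0, w)] [::]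
| tensor_addl v v' w : tensor_cong [:: (v + v', w)] [:: (v, w); (v', w)]
| tensor_addr v w w' : tensor_cong [:: (v, w + w')] [:: (v, w); (v, w')]
| tensor_scale a v w : tensor_cong [:: (a *: v, w)] [:: (v, a *: w)].

Definition tensor_rel : rel (seq (V * W)) := fun s t => `[< tensor_cong s t >].

Lemma tensor_rel_refl : reflexive tensor_rel.
Proof. by move=> s; apply/asboolP; exact: tensor_refl. Qed.

Lemma tensor_rel_sym : symmetric tensor_rel.
Proof. by move=> s t; apply/asboolP/asboolP; exact: tensor_sym. Qed.

Lemma tensor_rel_trans : transitive tensor_rel.
Proof.
move=> t s u /asboolP st /asboolP tu; apply/asboolP.
exact: tensor_trans st tu.
Qed.

Canonical tensor_equiv :=
  EquivRel tensor_rel tensor_rel_refl tensor_rel_sym tensor_rel_trans.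

End TensorCongruence.

Definition tensor (k : fieldType) (V W : lmodType k) : Type :=
  {eq_quot (@tensor_equiv k V W)}.

Notation "V ⊗ W" := (tensor V%type W%type) : type_scope.

Section TensorModule.
Context (k : fieldType) (V W : lmodType k).
Implicit Types s t : seq (V * W).

HB.instance Definition _ := Choice.on (V ⊗ W).

Definition tsum s : V ⊗ W := \pi_({eq_quot (@tensor_equiv k V W)}) s.

Definition trepr (t : V ⊗ W) : seq (V * W) :=
  repr (t : {eq_quot (@tensor_equiv k V W)}).

Lemma tsumP s t : tensor_cong s t <-> tsum s = tsum t.
Proof.
split=> [st|/eqP]; first by apply/eqP; rewrite eqmodE; apply/asboolP.
by rewrite eqmodE => /asboolP.
Qed.

Lemma tsum_trepr (t : V ⊗ W) : tsum (trepr t) = t.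
Proof. exact: reprK. Qed.

Lemma trepr_tsum s : tensor_cong (trepr (tsum s)) s.
Proof. by apply/tsumP; rewrite tsum_trepr. Qed.

Definition tadd (s t : V ⊗ W) : V ⊗ W := tsum (trepr s ++ trepr t).
Definition tscale (a : k) (t : V ⊗ W) : V ⊗ W :=
  tsum [seq (a *: p.1, p.2) | p <- trepr t].

Lemma cong_scale a s t : tensor_cong s t ->
  tensor_cong [seq (a *: p.1, p.2) | p <- s] [seq (a *: p.1, p.2) | p <- t].
Proof.
elim=> {s t} /=.
- by move=> s; exact: tensor_refl.
- by move=> s t _; exact: tensor_sym.
- by move=> s t u _ IH1 _ IH2; exact: tensor_trans IH1 IH2.
- by move=> s s' t t' _ IH1 _ IH2; rewrite !map_cat; exact: tensor_cat.
- by move=> s t; rewrite !map_cat; exact: tensor_catC.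
- by move=> w; rewrite scaler0; exact: tensor_zero.
- by move=> v v' w; rewrite scalerDr; exact: tensor_addl.
- by move=> v w w'; exact: tensor_addr.
- move=> b v w; rewrite scalerA mulrC -scalerA; exact: tensor_scale.
Qed.

Lemma tadd_sum s t : tadd (tsum s) (tsum t) = tsum (s ++ t).
Proof. by apply/tsumP/tensor_cat; exact: trepr_tsum. Qed.

Lemma tscale_sum a s :
  tscale a (tsum s) = tsum [seq (a *: p.1, p.2) | p <- s].
Proof. by apply/tsumP/cong_scale; exact: trepr_tsum. Qed.

Lemma tensor_ind_sum (P : V ⊗ W -> Prop) :
  (forall s, P (tsum s)) -> forall t : V ⊗ W, P t.
Proof. by move=> Ps t; rewrite -(tsum_trepr t). Qed.

Lemma taddA : associative tadd.
Proof.
elim/tensor_ind_sum=> s; elim/tensor_ind_sum=> t; elim/tensor_ind_sum=> u.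
by rewrite !tadd_sum catA.
Qed.

Lemma taddC : commutative tadd.
Proof.
elim/tensor_ind_sum=> s; elim/tensor_ind_sum=> t.
by rewrite !tadd_sum; apply/tsumP/tensor_catC.
Qed.

Lemma tadd0 : left_id (tsum [::]) tadd.
Proof. by elim/tensor_ind_sum=> s; rewrite tadd_sum. Qed.

Lemma tscaleDl (t : V ⊗ W) a b : tscale (a + b) t = tadd (tscale a t) (tscale b t).
Proof.
elim/tensor_ind_sum: t => s; rewrite !tscale_sum tadd_sum.
elim: s => [|[v w] s IH] //=.
rewrite -cat1s -tadd_sum IH tadd_sum; apply/tsumP.
rewrite scalerDl; apply: tensor_trans.
  by apply: tensor_cat; [exact: tensor_addl | exact: tensor_refl].
apply: (@tensor_cat k V W [:: (a *: v, w)] [:: (a *: v, w)]).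
  exact: tensor_refl.
have := tensor_cat (tensor_catC [:: (b *: v, w)]
  [seq (a *: p.1, p.2) | p <- s]) (tensor_refl [seq (b *: p.1, p.2) | p <- s]).
by rewrite -!catA.
Qed.

Lemma tscale0 (t : V ⊗ W) : tscale 0 t = tsum [::].
Proof.
elim/tensor_ind_sum: t => s; rewrite tscale_sum.
elim: s => [|[v w] s IH] //=.
rewrite -cat1s -tadd_sum IH tadd_sum cats0 scale0r.
by apply/tsumP; exact: tensor_zero.
Qed.

Lemma tscale1 : left_id 1 tscale.
Proof.
elim/tensor_ind_sum=> s; rewrite tscale_sum; congr tsum.
by rewrite -[RHS]map_id; apply: eq_map => -[v w]; rewrite scale1r.
Qed.

Lemma tscaleA a b (t : V ⊗ W) : tscale a (tscale b t) = tscale (a * b) t.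
Proof.
elim/tensor_ind_sum: t => s; rewrite !tscale_sum -map_comp; congr tsum.
by apply: eq_map => -[v w] /=; rewrite scalerA.
Qed.

Lemma tscaleDr : right_distributive tscale tadd.
Proof.
move=> a; elim/tensor_ind_sum=> s; elim/tensor_ind_sum=> t.
by rewrite tadd_sum !tscale_sum tadd_sum map_cat.
Qed.

Lemma taddN : left_inverse (tsum [::]) (tscale (-1)) tadd.
Proof. by move=> t; rewrite -{2}(tscale1 t) -tscaleDl addNr tscale0. Qed.

HB.instance Definition _ :=
  GRing.isZmodule.Build (V ⊗ W) taddA taddC tadd0 taddN.
HB.instance Definition _ := GRing.Zmodule_isLmodule.Build k (V ⊗ W)
  tscaleA tscale1 tscaleDr tscaleDl.

Definition pure_tensor (v : V) (w : W) : V ⊗ W := tsum [:: (v, w)].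

End TensorModule.

Notation "v ⊗ w" := (pure_tensor v w) : ring_scope.

(** For a bilinear [f], [tlift f] is the linear map with
[tlift f (v ⊗ w) = f v w]. It is only meaningful for bilinear [f]; for any
other [f] its value depends on a choice of representative. *)
Definition tlift (k : fieldType) (V W U : lmodType k) (f : V -> W -> U)
    (t : V ⊗ W) : U :=
  \sum_(p <- trepr t) f p.1 p.2.

Section TensorUniversal.
Context {k : fieldType}.
Implicit Types V W U : lmodType k.

Local Notation bilin f := (bilinear_for *:%R *:%R f).

Lemma tsumE V W (s : seq (V * W)) :
  tsum s = \sum_(p <- s) p.1 ⊗ p.2.
Proof.
elim: s => [|[v w] s IH]; first by rewrite big_nil.
by rewrite big_cons -IH -cat1s -tadd_sum.
Qed.

Lemma pure_tensor_bilinear V W : bilin (@pure_tensor k V W).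
Proof.
split.
- move=> w a v v'; rewrite /= /pure_tensor.
  have -> : a *: tsum [:: (v, w)] = tsum [:: (a *: v, w)] by exact: tscale_sum.
  have -> : tsum [:: (a *: v, w)] + tsum [:: (v', w)] =
            tsum ([:: (a *: v, w)] ++ [:: (v', w)]) by exact: tadd_sum.
  by apply/tsumP; exact: tensor_addl.
- move=> v a w w'; rewrite /= /pure_tensor.
  have -> : a *: tsum [:: (v, w)] = tsum [:: (a *: v, w)] by exact: tscale_sum.
  have -> : tsum [:: (a *: v, w)] + tsum [:: (v, w')] =
            tsum ([:: (a *: v, w)] ++ [:: (v, w')]) by exact: tadd_sum.
  apply/tsumP; apply: tensor_trans (tensor_addr _ _ _) _.
  rewrite -cat1s; apply: tensor_cat; last exact: tensor_refl.
  exact/tensor_sym/tensor_scale.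
Qed.

HB.instance Definition _ V W :=
  bilinear_isBilinear.Build k V W (tensor V W) *:%R *:%R (@pure_tensor k V W)
    (@pure_tensor_bilinear V W).

Lemma bilin_sum V W U (f : V -> W -> U) (s t : seq (V * W)) : bilin f ->
  tensor_cong s t -> \sum_(p <- s) f p.1 p.2 = \sum_(p <- t) f p.1 p.2.
Proof.
move=> [fl fr].
have flD w v v' : f (v + v') w = f v w + f v' w.
  by have := fl w 1 v v'; rewrite /= !scale1r.
have frD v w w' : f v (w + w') = f v w + f v w'.
  by have := fr v 1 w w'; rewrite /= !scale1r.
have fl0 w : f 0 w = 0 by apply: (addrI (f 0 w)); rewrite -flD !addr0.
have fr0 v : f v 0 = 0 by apply: (addrI (f v 0)); rewrite -frD !addr0.
elim=> {s t}.
- by [].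
- by move=> s t _ ->.
- by move=> s t u _ -> _ ->.
- by move=> s s' t t' _ e1 _ e2; rewrite !big_cat /= e1 e2.
- by move=> s t; rewrite !big_cat /= addrC.
- by move=> w; rewrite big_seq1 big_nil.
- by move=> v v' w; rewrite !big_cons !big_nil !addr0 /= flD.
- by move=> v w w'; rewrite !big_cons !big_nil !addr0 /= frD.
- move=> a v w; rewrite !big_seq1 /=.
  have := fl w a v 0; rewrite /= addr0 fl0 addr0 => ->.
  by have := fr v a w 0; rewrite /= addr0 fr0 addr0 => ->.
Qed.

Lemma tlift_sum V W U (f : V -> W -> U) (s : seq (V * W)) : bilin f ->
  tlift f (tsum s) = \sum_(p <- s) f p.1 p.2.
Proof. by move=> bf; apply: bilin_sum => //; exact: trepr_tsum. Qed.

Lemma tliftE V W U (f : V -> W -> U) v w : bilin f ->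
  tlift f (v ⊗ w) = f v w.
Proof. by move=> bf; rewrite tlift_sum // big_seq1. Qed.

Lemma tlift_linear V W U (f : V -> W -> U) : bilin f -> linear (tlift f).
Proof.
move=> bf a; elim/tensor_ind_sum=> s; elim/tensor_ind_sum=> t.
have -> : a *: tsum s = tsum [seq (a *: p.1, p.2) | p <- s].
  by exact: tscale_sum.
have -> : tsum [seq (a *: p.1, p.2) | p <- s] + tsum t =
          tsum ([seq (a *: p.1, p.2) | p <- s] ++ t) by exact: tadd_sum.
rewrite !tlift_sum // big_cat big_map /= scaler_sumr; congr (_ + _).
have [fl _] := bf; apply: eq_bigr => -[v w] _ /=.
have f0 : f 0 w = 0.
  by apply: (addrI (f 0 w)); have := fl w 1 0 0; rewrite /= !scale1r !addr0.
by have := fl w a v 0; rewrite /= f0 !addr0.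
Qed.

Lemma tensor_ext V W U (f g : V ⊗ W -> U) : linear f -> linear g ->
  (forall v w, f (v ⊗ w) = g (v ⊗ w)) -> f =1 g.
Proof.
move=> lf lg fg; elim/tensor_ind_sum=> s; rewrite tsumE.
have H (h : V ⊗ W -> U) : linear h ->
    h (\sum_(p <- s) p.1 ⊗ p.2) = \sum_(p <- s) h (p.1 ⊗ p.2).
  move=> lh; pose hM := GRing.isLinear.Build k _ _ _ h lh.
  by pose hL : {linear _ -> _} := HB.pack h hM; exact: (raddf_sum hL).
by rewrite !H //; apply: eq_bigr => p _; exact: fg.
Qed.

End TensorUniversal.

Section TensorMaps.
Context {k : fieldType}.
Implicit Types V W U X : lmodType k.

Local Notation bilin f := (bilinear_for *:%R *:%R f).

Lemma tensor_ind V W (P : V ⊗ W -> Prop) :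
  (forall v w, P (v ⊗ w)) -> (forall s t, P s -> P t -> P (s + t)) ->
  forall t, P t.
Proof.
move=> Pp PD; elim/tensor_ind_sum=> s; rewrite tsumE.
elim: s => [|p s IH]; last by rewrite big_cons; exact: PD.
by rewrite big_nil -(linear0l (@pure_tensor k V W) 0); exact: Pp.
Qed.

Definition tmap V W V' W' (f : V -> V') (g : W -> W') : V ⊗ W -> V' ⊗ W' :=
  tlift (fun v w => f v ⊗ g w).

Definition tswap V W : V ⊗ W -> W ⊗ V := tlift (fun v w => w ⊗ v).

Definition tassoc V W U : (V ⊗ W) ⊗ U -> V ⊗ (W ⊗ U) :=
  tlift (fun t u => tlift (fun v w => v ⊗ (w ⊗ u)) t).

Definition tassoc_inv V W U : V ⊗ (W ⊗ U) -> (V ⊗ W) ⊗ U :=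
  tlift (fun v t => tlift (fun w u => (v ⊗ w) ⊗ u) t).

Definition tinterchange V V' W W' :
    (V ⊗ V') ⊗ (W ⊗ W') -> (V ⊗ W) ⊗ (V' ⊗ W') :=
  tlift (fun s t =>
    tlift (fun v v' => tlift (fun w w' => (v ⊗ w) ⊗ (v' ⊗ w')) t) s).

Lemma tlift_bilin V W U X (f : X -> V -> W -> U) :
  (forall x, bilin (f x)) -> (forall v w, linear (fun x => f x v w)) ->
  bilin (fun x t => tlift (f x) t).
Proof.
move=> bf lf; split=> [t a x y|x a s t] /=; last exact: tlift_linear.
elim/tensor_ind: t => [v w|s t IHs IHt].
  by rewrite !tliftE //; exact: lf.
have D z : tlift (f z) (s + t) = tlift (f z) s + tlift (f z) t.
  by have := tlift_linear (bf z) 1 s t; rewrite !scale1r.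
by rewrite !D IHs IHt scalerDr addrACA.
Qed.

Lemma bilin_flip V W U (f : V -> W -> U) :
  bilin f -> bilin (fun w v => f v w).
Proof. by move=> [fl fr]; split. Qed.

Lemma tmap_bilin V W V' W' (f : {linear V -> V'}) (g : {linear W -> W'}) :
  bilin (fun v w => f v ⊗ g w).
Proof.
by split=> [w|v] a x y /=; rewrite linearP ?linearPl ?linearPr.
Qed.

Lemma tswap_bilin V W : bilin (fun (v : V) (w : W) => w ⊗ v).
Proof. exact/bilin_flip/pure_tensor_bilinear. Qed.

Lemma tassoc_bilin1 V W U (u : U) :
  bilin (fun (v : V) (w : W) => v ⊗ (w ⊗ u)).
Proof.
by split=> [w|v] a x y /=; rewrite ?linearPl ?linearPr.
Qed.

Lemma tassoc_bilin V W U :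
  bilin (fun t (u : U) => tlift (fun (v : V) (w : W) => v ⊗ (w ⊗ u)) t).
Proof.
apply/bilin_flip/tlift_bilin=> [u|v w a x y]; first exact: tassoc_bilin1.
by rewrite !linearPr.
Qed.

Lemma tassoc_inv_bilin1 V W U (v : V) :
  bilin (fun (w : W) (u : U) => (v ⊗ w) ⊗ u).
Proof.
by split=> [u|w] a x y /=; rewrite ?linearPr ?linearPl.
Qed.

Lemma tassoc_inv_bilin V W U :
  bilin (fun (v : V) t => tlift (fun (w : W) (u : U) => (v ⊗ w) ⊗ u) t).
Proof.
apply: tlift_bilin=> [v|w u a x y]; first exact: tassoc_inv_bilin1.
by rewrite !linearPl.
Qed.

Lemma tinterchange_bilin1 V V' W W' (v : V) (v' : V') :
  bilin (fun (w : W) (w' : W') => (v ⊗ w) ⊗ (v' ⊗ w')).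
Proof.
by split=> [w'|w] a x y /=; rewrite linearPr ?linearPl ?linearPr.
Qed.

Lemma tinterchange_bilin2 V V' W W' (t : W ⊗ W') :
  bilin (fun (v : V) (v' : V') =>
    tlift (fun w w' => (v ⊗ w) ⊗ (v' ⊗ w')) t).
Proof.
split=> [v'|v].
- suff [H _] : bilin (fun (v : V) (s : W ⊗ W') =>
      tlift (fun w w' => (v ⊗ w) ⊗ (v' ⊗ w')) s) by exact: H.
  apply: tlift_bilin=> [v|w w' a x y]; first exact: tinterchange_bilin1.
  by rewrite !linearPl.
- suff [H _] : bilin (fun (v' : V') (s : W ⊗ W') =>
      tlift (fun w w' => (v ⊗ w) ⊗ (v' ⊗ w')) s) by exact: H.
  apply: tlift_bilin=> [v'|w w' a x y]; first exact: tinterchange_bilin1.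
  by rewrite linearPl linearPr.
Qed.

Lemma tinterchange_bilin V V' W W' :
  bilin (fun (s : V ⊗ V') (t : W ⊗ W') =>
    tlift (fun v v' => tlift (fun w w' => (v ⊗ w) ⊗ (v' ⊗ w')) t) s).
Proof.
apply/bilin_flip/tlift_bilin=> [t|v v' a x y].
  exact: tinterchange_bilin2.
by apply: tlift_linear; exact: tinterchange_bilin1.
Qed.

HB.instance Definition _ V W V' W' (f : {linear V -> V'})
    (g : {linear W -> W'}) :=
  GRing.isLinear.Build k _ _ _ (tmap f g) (tlift_linear (tmap_bilin f g)).
HB.instance Definition _ V W :=
  GRing.isLinear.Build k _ _ _ (@tswap V W) (tlift_linear (@tswap_bilin V W)).
HB.instance Definition _ V W U :=
  GRing.isLinear.Build k _ _ _ (@tassoc V W U)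
    (tlift_linear (@tassoc_bilin V W U)).
HB.instance Definition _ V W U :=
  GRing.isLinear.Build k _ _ _ (@tassoc_inv V W U)
    (tlift_linear (@tassoc_inv_bilin V W U)).
HB.instance Definition _ V V' W W' :=
  GRing.isLinear.Build k _ _ _ (@tinterchange V V' W W')
    (tlift_linear (@tinterchange_bilin V V' W W')).

Definition contractl V W (phi : V -> k) : V ⊗ W -> W :=
  tlift (fun v w => phi v *: w).
Definition contractr V W (phi : W -> k) : V ⊗ W -> V :=
  tlift (fun v w => phi w *: v).

Lemma contractl_bilin V W (phi : {scalar V}) :
  bilin (fun v (w : W) => phi v *: w).
Proof.
split=> [w|v] a x y /=; first by rewrite linearP /= scalerDl scalerA.
by rewrite scalerDr !scalerA mulrC.
Qed.

Lemma contractr_bilin V W (phi : {scalar W}) :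
  bilin (fun (v : V) w => phi w *: v).
Proof. exact/bilin_flip/contractl_bilin. Qed.

HB.instance Definition _ V W (phi : {scalar V}) :=
  GRing.isLinear.Build k _ _ _ (@contractl V W phi)
    (tlift_linear (@contractl_bilin V W phi)).
HB.instance Definition _ V W (phi : {scalar W}) :=
  GRing.isLinear.Build k _ _ _ (@contractr V W phi)
    (tlift_linear (@contractr_bilin V W phi)).

Lemma contractlE V W (phi : {scalar V}) v (w : W) :
  contractl phi (v ⊗ w) = phi v *: w.
Proof. by rewrite /contractl tliftE //; exact: contractl_bilin. Qed.

Lemma contractrE V W (phi : {scalar W}) (v : V) w :
  contractr phi (v ⊗ w) = phi w *: v.
Proof. by rewrite /contractr tliftE //; exact: contractr_bilin. Qed.

Lemma tmapE V W V' W' (f : {linear V -> V'}) (g : {linear W -> W'}) v w :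
  tmap f g (v ⊗ w) = f v ⊗ g w.
Proof. by rewrite /tmap tliftE //; exact: tmap_bilin. Qed.

Lemma tswapE V W (v : V) (w : W) : tswap (v ⊗ w) = w ⊗ v.
Proof. by rewrite /tswap tliftE //; exact: tswap_bilin. Qed.

Lemma tassocE V W U (v : V) (w : W) (u : U) :
  tassoc ((v ⊗ w) ⊗ u) = v ⊗ (w ⊗ u).
Proof.
rewrite /tassoc tliftE ?tliftE //; first exact: tassoc_bilin1.
exact: tassoc_bilin.
Qed.

Lemma tassoc_invE V W U (v : V) (w : W) (u : U) :
  tassoc_inv (v ⊗ (w ⊗ u)) = (v ⊗ w) ⊗ u.
Proof.
rewrite /tassoc_inv tliftE ?tliftE //; first exact: tassoc_inv_bilin1.
exact: tassoc_inv_bilin.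
Qed.

Lemma tinterchangeE V V' W W' (v : V) (v' : V') (w : W) (w' : W') :
  tinterchange ((v ⊗ v') ⊗ (w ⊗ w')) = (v ⊗ w) ⊗ (v' ⊗ w').
Proof.
rewrite /tinterchange tliftE; last exact: tinterchange_bilin.
rewrite tliftE; last exact: tinterchange_bilin2.
by rewrite tliftE //; exact: tinterchange_bilin1.
Qed.

End TensorMaps.

(** * Coalgebras and Hopf algebras *)

Record coalgebra (k : fieldType) := Coalgebra {
  coalg_sort :> lmodType k;
  comul : {linear coalg_sort -> (coalg_sort ⊗ coalg_sort)%type};
  counit : {scalar coalg_sort};
  comulA : forall x, tassoc (tmap comul idfun (comul x)) = tmap idfun comul (comul x);
  counitl : forall x, contractl counit (comul x) = x;
  counitr : forall x, contractr counit (comul x) = x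
}.

Arguments comul {k c}.
Arguments counit {k c}.

(** Sweedler notation: the value at [Δ(x)] of the linear map
[x1 ⊗ x2 |-> E], for [E] bilinear in [(x1, x2)]. *)
Notation "\sw_ ( x1 , x2 <- x ) E" :=
  (tlift (fun x1 x2 => E) (comul x)) : ring_scope.

Definition cocommutative (k : fieldType) (C : coalgebra k) : Prop :=
  forall x : C, tswap (comul x) = comul x.

Record coalg_morphism (k : fieldType) (C D : coalgebra k) (f : C -> D) : Prop :=
  CoalgMorphism {
    coalg_morphism_linear : linear f;
    coalg_morphism_comul : forall x, comul (f x) = tmap f f (comul x);
    coalg_morphism_counit : forall x, counit (f x) = counit x
  }.

Definition coalg_isomorphism (k : fieldType) (C D : coalgebra k) (f : C -> D) :
    Prop :=
  coalg_morphism f /\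
  exists g : D -> C, [/\ coalg_morphism g, cancel f g & cancel g f].

Section TensorCoalgebra.
Context {k : fieldType} (C D : coalgebra k).

Definition tensor_comul : C ⊗ D -> (C ⊗ D) ⊗ (C ⊗ D) :=
  @tinterchange k C C D D \o tmap comul comul.

Definition tensor_counit : C ⊗ D -> k :=
  @tlift k C D k^o (fun x y => counit x * counit y).

HB.instance Definition _ := GRing.Linear.on tensor_comul.

Lemma counit_bilin : bilinear_for *:%R *:%R
  (fun (x : C) (y : D) => (counit x * counit y : k^o)).
Proof.
split=> [y|x] a u v /=; rewrite linearP /=; first by rewrite mulrDl -mulrA.
by rewrite mulrDr mulrCA.
Qed.

Lemma tensor_counit_scalar : scalar tensor_counit.
Proof. exact: tlift_linear counit_bilin. Qed.

HB.instance Definition _ :=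
  GRing.isLinear.Build k (C ⊗ D)%type k _ tensor_counit tensor_counit_scalar.

Lemma tensor_comulE x y :
  tensor_comul (x ⊗ y) = tinterchange (comul x ⊗ comul y).
Proof. by rewrite /tensor_comul /= tmapE. Qed.

Lemma tensor_counitE x y : tensor_counit (x ⊗ y) = counit x * counit y.
Proof. exact: tliftE counit_bilin. Qed.

Lemma tensor_comulA t :
  tassoc (tmap tensor_comul idfun (tensor_comul t)) =
  tmap idfun tensor_comul (tensor_comul t).
Proof.
elim/(@tensor_ind k C D): t => [x y|s t]; last by rewrite !linearD /= => -> ->.
rewrite tensor_comulE.
have L (s : C ⊗ C) (t : D ⊗ D) :
    tassoc (tmap tensor_comul idfun (tinterchange (s ⊗ t))) =
    tmap idfun (@tinterchange k C C D D)
      (tinterchange (tassoc (tmap comul idfun s) ⊗ tassoc (tmap comul idfun t))).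
  elim/(@tensor_ind k C C): s => [a b|s s' IH IH'];
    last by rewrite !(linearD, linearDl) /= IH IH'.
  elim/(@tensor_ind k D D): t => [c d|t t' IH IH'];
    last by rewrite !(linearD, linearDr) /= IH IH'.
  rewrite tinterchangeE !tmapE /= tensor_comulE.
  elim/(@tensor_ind k C C): (comul a) => [a1 a2|s s' IH IH'];
    last by rewrite !(linearD, linearDl) /= IH IH'.
  elim/(@tensor_ind k D D): (comul c) => [c1 c2|s s' IH IH'];
    last by rewrite !(linearD, linearDl, linearDr) /= IH IH'.
  by rewrite !(tassocE, tinterchangeE, tmapE) /= tinterchangeE.
have R (s : C ⊗ C) (t : D ⊗ D) :
    tmap idfun tensor_comul (tinterchange (s ⊗ t)) =
    tmap idfun (@tinterchange k C C D D)
      (tinterchange (tmap idfun comul s ⊗ tmap idfun comul t)).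
  elim/(@tensor_ind k C C): s => [a b|s s' IH IH'];
    last by rewrite !(linearD, linearDl) /= IH IH'.
  elim/(@tensor_ind k D D): t => [c d|t t' IH IH'];
    last by rewrite !(linearD, linearDr) /= IH IH'.
  by rewrite tinterchangeE !tmapE /= tensor_comulE tinterchangeE tmapE.
by rewrite L R !comulA.
Qed.

Lemma tensor_counitl t : contractl tensor_counit (tensor_comul t) = t.
Proof.
elim/(@tensor_ind k C D): t => [x y|s t]; last first.
  by rewrite !linearD /= => -> ->.
have E (s : C ⊗ C) (t : D ⊗ D) :
    contractl tensor_counit (tinterchange (s ⊗ t)) =
    contractl counit s ⊗ contractl counit t.
  elim/(@tensor_ind k C C): s => [a b|s s' IH IH'];
    last by rewrite !(linearD, linearDl) /= IH IH'.
  elim/(@tensor_ind k D D): t => [c d|t t' IH IH'];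
    last by rewrite !(linearD, linearDr) /= IH IH'.
  rewrite tinterchangeE !contractlE /= tensor_counitE.
  by rewrite linearZr_LR linearZl_LR /= scalerA mulrC.
by rewrite tensor_comulE E !counitl.
Qed.

Lemma tensor_counitr t : contractr tensor_counit (tensor_comul t) = t.
Proof.
elim/(@tensor_ind k C D): t => [x y|s t]; last first.
  by rewrite !linearD /= => -> ->.
have E (s : C ⊗ C) (t : D ⊗ D) :
    contractr tensor_counit (tinterchange (s ⊗ t)) =
    contractr counit s ⊗ contractr counit t.
  elim/(@tensor_ind k C C): s => [a b|s s' IH IH'];
    last by rewrite !(linearD, linearDl) /= IH IH'.
  elim/(@tensor_ind k D D): t => [c d|t t' IH IH'];
    last by rewrite !(linearD, linearDr) /= IH IH'.
  rewrite tinterchangeE !contractrE /= tensor_counitE.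
  by rewrite linearZr_LR linearZl_LR /= scalerA mulrC.
by rewrite tensor_comulE E !counitr.
Qed.

Definition tensor_coalgebra : coalgebra k :=
  @Coalgebra k (C ⊗ D)%type tensor_comul tensor_counit
    tensor_comulA tensor_counitl tensor_counitr.

End TensorCoalgebra.

(** A Hopf algebra structure on a given coalgebra. *)
Record hopf_algebra (k : fieldType) (C : coalgebra k) := HopfAlgebra {
  hmul : {bilinear C -> C -> C};
  hone : C;
  antipode : {linear C -> C};
  hmulA : associative hmul;
  hmul1l : left_id hone hmul;
  hmul1r : right_id hone hmul;
  comulM : forall a b : C, comul (hmul a b) =
    \sw_(a1, a2 <- a) \sw_(b1, b2 <- b) (hmul a1 b1 ⊗ hmul a2 b2);
  comul1 : comul hone = hone ⊗ hone;
  counitM : forall a b : C, counit (hmul a b) = counit a * counit b;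
  counit1 : counit hone = 1;
  antipodel : forall a : C,
    \sw_(a1, a2 <- a) hmul (antipode a1) a2 = counit a *: hone;
  antipoder : forall a : C,
    \sw_(a1, a2 <- a) hmul a1 (antipode a2) = counit a *: hone
}.

Notation "a *[ H ] b" := (hmul H a b) : ring_scope.

(** [dot] and [circ] are the Hopf algebra structures [(A, ·, 1, Δ, ε, S)] and
[(A, ∘, 1_∘, Δ, ε, T)]. *)
Record hopf_brace (k : fieldType) := HopfBrace {
  brace_coalgebra :> coalgebra k;
  dot : hopf_algebra brace_coalgebra;
  circ : hopf_algebra brace_coalgebra;
  braceP : forall a b c : brace_coalgebra,
    a *[circ] (b *[dot] c) =
    \sw_(a1, a' <- a) \sw_(a2, a3 <- a')
      (((a1 *[circ] b) *[dot] antipode dot a2) *[dot] (a3 *[circ] c))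
}.

Arguments dot {k h}.
Arguments circ {k h}.

Section HopfBraceActions.
Context {k : fieldType} {A : hopf_brace k}.
Implicit Types a b x y : A.

Definition harpoon_right a b : A :=
  \sw_(a1, a2 <- a) (antipode dot a1 *[dot] (a2 *[circ] b)).

Local Notation "a ⇀ b" := (harpoon_right a b) : ring_scope.

Definition harpoon_left a b : A :=
  \sw_(a1, a2 <- a) \sw_(b1, b2 <- b)
    ((antipode circ (a1 ⇀ b1) *[circ] a2) *[circ] b2).

Local Notation "a ↼ b" := (harpoon_left a b) : ring_scope.

Definition braiding_pure x y : A ⊗ A :=
  \sw_(x1, x2 <- x) \sw_(y1, y2 <- y) ((x1 ⇀ y1) ⊗ (x2 ↼ y2)).

Definition braiding : A ⊗ A -> A ⊗ A := tlift braiding_pure.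

End HopfBraceActions.

Notation "a ⇀ b" := (harpoon_right a b) : ring_scope.
Notation "a ↼ b" := (harpoon_left a b) : ring_scope.

Section BraidEquation.
Context {k : fieldType} {V : lmodType k}.

(** The two maps [c ⊗ id] and [id ⊗ c] on [V ⊗ V ⊗ V = (V ⊗ V) ⊗ V]. *)
Definition braid12 (c : V ⊗ V -> V ⊗ V) : V ⊗ V ⊗ V -> V ⊗ V ⊗ V :=
  tmap c idfun.
Definition braid23 (c : V ⊗ V -> V ⊗ V) : V ⊗ V ⊗ V -> V ⊗ V ⊗ V :=
  @tassoc_inv k V V V \o tmap idfun c \o @tassoc k V V V.

Definition braid_equation (c : V ⊗ V -> V ⊗ V) : Prop :=
  braid12 c \o braid23 c \o braid12 c =1 braid23 c \o braid12 c \o braid23 c.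

End BraidEquation.

(* Main.v *)
Require Import Defs.
From mathcomp Require Import all_boot all_order all_algebra.
From HB Require Import structures.
From mathcomp Require Import boolp.

(** The proof is a Yoneda argument that reduces everything to ordinary groups.

Cocommutative coalgebras and coalgebra morphisms form a category with finite
products: the product of [C] and [D] is [C ⊗ D], and two morphisms [f], [g] out
of [X] are paired into [pair_fun f g = (f ⊗ g) Δ], which is a morphism because
[X] is cocommutative ([hom_pair]). A cocommutative Hopf algebra [A] is a group
object of this category: for each cocommutative [C], the set of points
[coalg_hom C A] is a group under convolution ([point_group]). The one fact here
that is not immediate is that the antipode is itself a coalgebra morphism
([antipode_hom_subproof]). In the same way a cocommutative Hopf brace is a skew
brace object: the points over [C] form a set-theoretic skew brace
([point_brace]), functorially in [C].

For a set-theoretic skew brace the map [r(a, b) = (a ⇀ b, a ↼ b)] is invertible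
and satisfies the braid relation ([sb_rK], [sb_rinvK], [sb_braid]). Indeed
[⇀] is a left action of the group [∘], [↼] is a right action of it, and
[(a ⇀ b) ∘ (a ↼ b) = a ∘ b]. The braid relation compares two triples: the outer
components agree because these are actions, and then the middle ones agree
because both sides preserve the product [∘] of the three components.

The two projections [A ⊗ A -> A] are points over [A ⊗ A]; applying [r] to them
and pairing the result gives a coalgebra endomorphism [braiding_hom] of
[A ⊗ A], and by naturality composing with it computes [r] on all pairs of
points. Hence the inverse of [r], applied to the projections, is the inverse of
[braiding_hom], and the braid relation for [r], applied to the three projections
of [A ⊗ A ⊗ A], is the braid equation. Finally [braiding_hom] is the map of the
theorem ([braidingE]): this is an expansion in Sweedler notation, where the
only simplification is [x1 ⊗ ε(y1) (x2 ⊗ y2) = x1 ⊗ (x2 ⊗ y)]. *)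

Set Implicit Arguments.
Unset Strict Implicit.
Unset Printing Implicit Defensive.

Import GRing.Theory.
Local Open Scope ring_scope.

(** * Set-theoretic skew braces *)

Record group_law (G : Type) := GroupLaw {
  gmul : G -> G -> G;
  gone : G;
  ginv : G -> G;
  gmulA : associative gmul;
  gmul1l : left_id gone gmul;
  gmul1r : right_id gone gmul;
  gmulVl : left_inverse gone ginv gmul;
  gmulVr : right_inverse gone ginv gmul
}.

Section GroupLaw.
Context (G : Type) (H : group_law G).
Local Notation "a * b" := (gmul H a b).
Local Notation "a ^-1" := (ginv H a).

Lemma gmulKl a : cancel (gmul H a) (gmul H a^-1).
Proof. by move=> b; rewrite gmulA gmulVl gmul1l. Qed.

Lemma gmulKVl a : cancel (gmul H a^-1) (gmul H a).
Proof. by move=> b; rewrite gmulA gmulVr gmul1l. Qed.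

Lemma gmulKr a : cancel (fun b => b * a) (fun b => b * a^-1).
Proof. by move=> b; rewrite -gmulA gmulVr gmul1r. Qed.

Lemma ginv_unique a b : a * b = gone H -> b = a^-1.
Proof. by move=> ab; rewrite -(gmulKl a b) ab gmul1r. Qed.

Lemma ginvK : involutive (ginv H).
Proof. by move=> a; rewrite -(@ginv_unique a^-1 a) ?gmulVl. Qed.

Lemma ginvM a b : (a * b)^-1 = b^-1 * a^-1.
Proof. by apply/esym/ginv_unique; rewrite -gmulA gmulKVl gmulVr. Qed.

End GroupLaw.

Record skew_brace := SkewBrace {
  sb_sort :> Type;
  sb_dot : group_law sb_sort;
  sb_circ : group_law sb_sort;
  sb_braceP : forall a b c, gmul sb_circ a (gmul sb_dot b c) =
    gmul sb_dot (gmul sb_dot (gmul sb_circ a b) (ginv sb_dot a))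
      (gmul sb_circ a c)
}.

Section SkewBrace.
Context (G : skew_brace).
Local Notation dot := (sb_dot G).
Local Notation circ := (sb_circ G).
Local Notation "a · b" := (gmul dot a b) (at level 40, left associativity).
Local Notation "a ∘ b" := (gmul circ a b) (at level 40, left associativity).
Implicit Types a b c u v : G.

Definition sb_right a b := ginv dot a · (a ∘ b).
Definition sb_left a b := ginv circ (sb_right a b) ∘ (a ∘ b).
Local Notation "a ▷ b" := (sb_right a b) (at level 40).
Local Notation "a ◁ b" := (sb_left a b) (at level 40).

Lemma sb_circE a b : a ∘ b = a · (a ▷ b).
Proof. by rewrite gmulKVl. Qed.

Lemma sb_rightM a b c : a ▷ (b · c) = (a ▷ b) · (a ▷ c).
Proof. by rewrite /sb_right sb_braceP !gmulA. Qed.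

Lemma sb_right1 a : a ▷ gone dot = gone dot.
Proof.
by rewrite -[LHS](gmulKl dot (a ▷ gone dot)) -sb_rightM gmul1l gmulVl.
Qed.

Lemma sb_rightV a b : a ▷ ginv dot b = ginv dot (a ▷ b).
Proof. by apply: ginv_unique; rewrite -sb_rightM gmulVr sb_right1. Qed.

(** Expand [b ▷ c = b⁻¹ · (b ∘ c)]: as [a ▷ _] is an endomorphism of the group
[·], the factor [a ▷ b⁻¹ = (a ∘ b)⁻¹ · a] cancels against
[a ▷ (b ∘ c) = a⁻¹ · (a ∘ b ∘ c)]. *)
Lemma sb_right_circ a b c : (a ∘ b) ▷ c = a ▷ (b ▷ c).
Proof.
rewrite [b ▷ c]/sb_right sb_rightM sb_rightV {2 3}/sb_right.
by rewrite ginvM ginvK -gmulA gmulKVl gmulA.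
Qed.

Lemma sb_right_left a b : (a ▷ b) ∘ (a ◁ b) = a ∘ b.
Proof. exact: gmulKVl. Qed.

(** Once [∘] is rewritten through [·] and [▷], this is [sb_rightM] together with
the two ways [a ▷ (b ▷ c) = (a ∘ b) ▷ c = (a ▷ b) ▷ ((a ◁ b) ▷ c)] of composing
the action. It is what makes [◁] a right action. *)
Lemma sb_right_mul a b c : a ▷ (b ∘ c) = (a ▷ b) ∘ ((a ◁ b) ▷ c).
Proof.
by rewrite !sb_circE sb_rightM -!sb_right_circ sb_right_left.
Qed.

Lemma sb_left_circ a b c : a ◁ (b ∘ c) = (a ◁ b) ◁ c.
Proof.
by rewrite /sb_left sb_right_mul ginvM /sb_left -!gmulA.
Qed.

Definition sb_r (p : G * G) : G * G := (p.1 ▷ p.2, p.1 ◁ p.2).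

(** If [sb_r (a, b) = (u, v)], then [u ∘ v = a ∘ b = a · (a ▷ b) = a · u], which
determines [a] and then [b]. *)
Definition sb_rinv (p : G * G) : G * G :=
  let a := (p.1 ∘ p.2) · ginv dot p.1 in (a, ginv circ a ∘ (p.1 ∘ p.2)).

Lemma sb_rK : cancel sb_r sb_rinv.
Proof.
case=> a b; rewrite /sb_rinv /= sb_right_left.
have -> : (a ∘ b) · ginv dot (a ▷ b) = a.
  by rewrite /sb_right ginvM ginvK gmulA gmulVr gmul1l.
by rewrite gmulKl.
Qed.

Lemma sb_rinvK : cancel sb_rinv sb_r.
Proof.
case=> u v; rewrite /sb_r /sb_rinv /sb_left /sb_right /= gmulKVl.
by rewrite ginvM ginvK -gmulA gmulVl gmul1r gmulKl.
Qed.

Definition sb_r12 (t : G * G * G) := (sb_r t.1, t.2).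
Definition sb_r23 (t : G * G * G) :=
  let p := sb_r (t.1.2, t.2) in (t.1.1, p.1, p.2).

Lemma sb_braid : sb_r12 \o sb_r23 \o sb_r12 =1 sb_r23 \o sb_r12 \o sb_r23.
Proof.
case=> -[a b] c; rewrite /sb_r12 /sb_r23 /sb_r /=.
have E1 : (a ▷ b) ▷ ((a ◁ b) ▷ c) = a ▷ (b ▷ c).
  by rewrite -!sb_right_circ sb_right_left.
have E3 : (a ◁ b) ◁ c = (a ◁ (b ▷ c)) ◁ (b ◁ c).
  by rewrite -!sb_left_circ sb_right_left.
have E2 : (a ▷ b) ◁ ((a ◁ b) ▷ c) = (a ◁ (b ▷ c)) ▷ (b ◁ c).
  (* Both triples have the ∘-product a ∘ b ∘ c, and they share their outer
     components. *)
  have L : (a ▷ (b ▷ c)) ∘ ((a ▷ b) ◁ ((a ◁ b) ▷ c)) ∘ ((a ◁ b) ◁ c) =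
      a ∘ b ∘ c.
    by rewrite -{1}E1 sb_right_left -gmulA sb_right_left gmulA sb_right_left.
  have R : (a ▷ (b ▷ c)) ∘ ((a ◁ (b ▷ c)) ▷ (b ◁ c)) ∘ ((a ◁ b) ◁ c) =
      a ∘ b ∘ c.
    by rewrite E3 -gmulA sb_right_left gmulA sb_right_left -gmulA
      sb_right_left gmulA.
  apply: (can_inj (gmulKl circ (a ▷ (b ▷ c)))).
  by apply: (can_inj (gmulKr circ ((a ◁ b) ◁ c))); rewrite /= L R.
by rewrite E1 E2 E3.
Qed.

End SkewBrace.

(** * Linear maps on tensor products *)

Section TensorLemmas.
Context {k : fieldType}.
Implicit Types V W U X : lmodType k.

(** Sweedler notation is only a way of writing a linear map on a tensor product:
with [t = comul x], the left-hand side is the sum over [x1 ⊗ x2] of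
[f (x1 ⊗ x2)]. *)
Lemma tlift_pure V W U (f : V ⊗ W -> U) t : linear f ->
  tlift (fun v w => f (v ⊗ w)) t = f t.
Proof.
move=> lf; have bf : bilinear_for *:%R *:%R (fun v w => f (v ⊗ w)).
  by split=> [w|v] a x y /=; rewrite ?linearPl ?linearPr lf.
apply: (tensor_ext (f := tlift _)) => //; first exact: tlift_linear.
by move=> v w; rewrite tliftE.
Qed.

Lemma tensor_ind3 V W U (P : V ⊗ W ⊗ U -> Prop) :
  (forall v w u, P (v ⊗ w ⊗ u)) -> (forall s t, P s -> P t -> P (s + t)) ->
  forall t, P t.
Proof.
move=> Pp PD; elim/(@tensor_ind k (V ⊗ W)%type U)=> [t u|]; last exact: PD.
elim/(@tensor_ind k V W): t => [v w|s t IHs IHt]; first exact: Pp.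
by rewrite linearDl; exact: PD.
Qed.

Lemma tmap_comp V V' V'' W W' W'' (f' : {linear V' -> V''})
    (g' : {linear W' -> W''}) (f : {linear V -> V'}) (g : {linear W -> W'}) t :
  tmap f' g' (tmap f g t) = tmap (f' \o f) (g' \o g) t.
Proof.
elim/(@tensor_ind k V W): t => [v w|s t IHs IHt]; first by rewrite !tmapE.
by rewrite !linearD /= IHs IHt.
Qed.

Lemma tmap_id V W (t : V ⊗ W) : tmap idfun idfun t = t.
Proof.
elim/(@tensor_ind k V W): t => [v w|s t IHs IHt]; first by rewrite tmapE.
by rewrite linearD /= IHs IHt.
Qed.

Lemma tmap_swap V V' W W' (f : {linear V -> V'}) (g : {linear W -> W'}) t :
  tswap (tmap f g t) = tmap g f (tswap t).
Proof.
elim/(@tensor_ind k V W): t => [v w|s t IHs IHt].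
  by rewrite !(tmapE, tswapE).
by rewrite !linearD /= IHs IHt.
Qed.

Lemma tmap_assoc V V' W W' U U' (f : {linear V -> V'}) (g : {linear W -> W'})
    (h : {linear U -> U'}) t :
  tassoc (tmap (tmap f g) h t) = tmap f (tmap g h) (tassoc t).
Proof.
elim/(@tensor_ind3 V W U): t => [v w u|s t IHs IHt].
  by rewrite !tmapE /= tmapE !tassocE tmapE /= tmapE.
by rewrite !linearD /= IHs IHt.
Qed.

Lemma tassocK V W U : cancel (@tassoc k V W U) (@tassoc_inv k V W U).
Proof.
elim/(@tensor_ind3 V W U) => [v w u|s t IHs IHt].
  by rewrite tassocE tassoc_invE.
by rewrite !linearD /= IHs IHt.
Qed.

(** The exchange of the two last factors generates, up to reassociation, the
interchange of the two middle factors among four. *)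
Definition trswap V W U : V ⊗ W ⊗ U -> V ⊗ U ⊗ W :=
  @tassoc_inv k V U W \o tmap idfun (@tswap k W U) \o @tassoc k V W U.
HB.instance Definition _ V W U := GRing.Linear.on (@trswap V W U).

Lemma trswapE V W U (v : V) (w : W) (u : U) : trswap (v ⊗ w ⊗ u) = v ⊗ u ⊗ w.
Proof. by rewrite /trswap /= tassocE tmapE /= tswapE tassoc_invE. Qed.

Lemma tinterchange_rswap V V' W W' (s : (V ⊗ V') ⊗ (W ⊗ W')) :
  tinterchange s = tassoc (tmap (@trswap V V' W) idfun (tassoc_inv s)).
Proof.
elim/(@tensor_ind3 V V' (W ⊗ W')%type): s => [v v' u|s t IHs IHt];
  last by rewrite !linearD /= IHs IHt.
elim/(@tensor_ind k W W'): u => [w w'|u u' IH IH'];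
  last by rewrite linearDr !linearD /= IH IH'.
by rewrite tinterchangeE tassoc_invE tmapE /= trswapE tassocE.
Qed.

End TensorLemmas.

(** * Pairing of linear maps along the comultiplication *)

(** [pair_fun f g] sends [x] to [f x1 ⊗ g x2]. The algebra of these maps replaces
calculations with iterated Sweedler indices: coassociativity is [pair_assoc], and
cocommutativity is the permission to permute the components. *)
Section Pair.
Context {k : fieldType} {C : coalgebra k}.
Implicit Types V W U X : lmodType k.

Definition pair_fun V W (f : C -> V) (g : C -> W) : C -> V ⊗ W :=
  tmap f g \o comul.
HB.instance Definition _ V W (f : {linear C -> V}) (g : {linear C -> W}) :=
  GRing.Linear.on (pair_fun f g).

Lemma tmap_pair V V' W W' (f' : {linear V -> V'}) (g' : {linear W -> W'})
    (f : {linear C -> V}) (g : {linear C -> W}) x :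
  tmap f' g' (pair_fun f g x) = pair_fun (f' \o f) (g' \o g) x.
Proof. by rewrite /pair_fun /= tmap_comp. Qed.

Lemma eq_pair V W (f f' : C -> V) (g g' : C -> W) :
  f =1 f' -> g =1 g' -> pair_fun f g =1 pair_fun f' g'.
Proof. by move=> /funext -> /funext ->. Qed.

Lemma pair_assoc V W U (f : {linear C -> V}) (g : {linear C -> W})
    (h : {linear C -> U}) x :
  tassoc (pair_fun (pair_fun f g) h x) = pair_fun f (pair_fun g h) x.
Proof.
have -> : pair_fun (pair_fun f g) h x =
    tmap (tmap f g) h (tmap comul idfun (comul x)) by rewrite tmap_comp.
by rewrite tmap_assoc comulA tmap_comp.
Qed.

Lemma pair_assoc_inv V W U (f : {linear C -> V}) (g : {linear C -> W})
    (h : {linear C -> U}) x :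
  tassoc_inv (pair_fun f (pair_fun g h) x) = pair_fun (pair_fun f g) h x.
Proof. by rewrite -pair_assoc tassocK. Qed.

Context (cC : cocommutative C).

Lemma pair_swap V W (f : {linear C -> V}) (g : {linear C -> W}) x :
  tswap (pair_fun f g x) = pair_fun g f x.
Proof. by rewrite /pair_fun /= tmap_swap cC. Qed.

Lemma pair_rswap V W U (f : {linear C -> V}) (g : {linear C -> W})
    (h : {linear C -> U}) x :
  trswap (pair_fun (pair_fun f g) h x) = pair_fun (pair_fun f h) g x.
Proof.
rewrite -(pair_assoc_inv f h) /trswap /= pair_assoc tmap_pair.
by congr tassoc_inv; apply: eq_pair => // y /=; rewrite pair_swap.
Qed.

Lemma pair_interchange V V' W W' (f : {linear C -> V}) (f' : {linear C -> V'})
    (g : {linear C -> W}) (g' : {linear C -> W'}) x :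
  tinterchange (pair_fun (pair_fun f f') (pair_fun g g') x) =
  pair_fun (pair_fun f g) (pair_fun f' g') x.
Proof.
rewrite tinterchange_rswap pair_assoc_inv tmap_pair.
rewrite -(pair_assoc (pair_fun f g)).
by congr tassoc; apply: eq_pair => // y /=; rewrite pair_rswap.
Qed.

End Pair.

(** * The category of coalgebras *)

Record coalg_hom (k : fieldType) (C D : coalgebra k) := CoalgHom {
  hom_fun :> C -> D;
  homP : coalg_morphism hom_fun
}.

Section HomLinear.
Context {k : fieldType} (C D : coalgebra k) (f : coalg_hom C D).
HB.instance Definition _ :=
  GRing.isLinear.Build k C D _ f (coalg_morphism_linear (homP f)).
Lemma hom_comul x : comul (f x) = pair_fun f f x.
Proof. exact: coalg_morphism_comul (homP f) x. Qed.
Lemma hom_counit x : counit (f x) = counit x.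
Proof. exact: coalg_morphism_counit (homP f) x. Qed.
(** Equality of bundled morphisms is pointwise, so that the laws of the groups of
points can be stated as equations. *)
Lemma hom_ext (g : coalg_hom C D) : f =1 g -> f = g.
Proof.
case: f g => [u Pu] [v Pv] /= /funext uv; case: _ / uv Pv => Pv.
by congr CoalgHom; exact: Prop_irrelevance.
Qed.
Lemma pair_hom (V W : lmodType k) (u : {linear D -> V}) (v : {linear D -> W})
    x :
  pair_fun u v (f x) = pair_fun (u \o f) (v \o f) x.
Proof. by rewrite {1}/pair_fun /= hom_comul tmap_pair. Qed.
End HomLinear.

Section HomCategory.
Context {k : fieldType}.
Implicit Types B C D E : coalgebra k.

Lemma hom_id_subproof C : @coalg_morphism k C C idfun.
Proof. by split=> // x; rewrite tmap_id. Qed.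
Definition hom_id C := CoalgHom (hom_id_subproof C).

Lemma hom_comp_subproof C D E (g : coalg_hom D E) (f : coalg_hom C D) :
  coalg_morphism (g \o f).
Proof.
split=> [a x y|x|x] /=; first by rewrite !linearP.
  by rewrite hom_comul pair_hom.
by rewrite !hom_counit.
Qed.
Definition hom_comp C D E (g : coalg_hom D E) (f : coalg_hom C D) :=
  CoalgHom (hom_comp_subproof g f).

Lemma contractl_pair C D (V : lmodType k) (f : {linear C -> D})
    (g : {linear C -> V}) x :
  (forall y, counit (f y) = counit y) ->
  contractl counit (pair_fun f g x) = g x.
Proof.
move=> fe; rewrite -{2}(counitl x) /pair_fun /=.
elim/(@tensor_ind k C C): (comul x) => [u v|s t IH IH'].
  by rewrite tmapE !contractlE /= fe linearZ.
by rewrite !linearD /= IH IH'.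
Qed.

Lemma contractr_pair C D (V : lmodType k) (f : {linear C -> V})
    (g : {linear C -> D}) x :
  (forall y, counit (g y) = counit y) ->
  contractr counit (pair_fun f g x) = f x.
Proof.
move=> ge; rewrite -{2}(counitr x) /pair_fun /=.
elim/(@tensor_ind k C C): (comul x) => [u v|s t IH IH'].
  by rewrite tmapE !contractrE /= ge linearZ.
by rewrite !linearD /= IH IH'.
Qed.

Lemma tensor_counit_contractl C D (t : C ⊗ D) :
  tensor_counit t = counit (contractl counit t).
Proof.
elim/(@tensor_ind k C D): t => [x y|s t IH IH'].
  by rewrite tensor_counitE contractlE linearZ.
by rewrite !linearD /= IH IH'.
Qed.

(** Cocommutativity is used to regroup [f x1 ⊗ f x2 ⊗ g x3 ⊗ g x4] into
[f x1 ⊗ g x2 ⊗ f x3 ⊗ g x4]. *)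
Lemma hom_pair_subproof C D E (cC : cocommutative C) (f : coalg_hom C D)
    (g : coalg_hom C E) :
  @coalg_morphism k C (tensor_coalgebra D E) (pair_fun f g).
Proof.
split=> [a x y|x|x]; first by rewrite linearP.
  rewrite [LHS]/= /tensor_comul /= tmap_pair.
  apply: etrans (pair_interchange cC f f g g x).
  by congr tinterchange; apply: eq_pair => y; rewrite /= hom_comul.
rewrite [LHS]/= tensor_counit_contractl contractl_pair ?hom_counit // => y.
exact: hom_counit.
Qed.
Definition hom_pair C D E (cC : cocommutative C) (f : coalg_hom C D)
    (g : coalg_hom C E) :=
  CoalgHom (hom_pair_subproof cC f g).

Lemma hom_fst_subproof C D :
  @coalg_morphism k (tensor_coalgebra C D) C (contractr counit).
Proof.
split=> [a x y|t|t]; first by rewrite linearP.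
  elim/(@tensor_ind k C D): t => [x y|s t IH IH']; last first.
    by rewrite !linearD /= IH IH'.
  rewrite contractrE linearZ -{1}(counitl y) /= tensor_comulE.
  move: (comul x) (comul y) => s u.
  elim/(@tensor_ind k D D): u => [u u'|u u' IH IH']; last first.
    by rewrite linearDr !linearD /= scalerDl IH IH'.
  elim/(@tensor_ind k C C): s => [c c'|s s' IH IH']; last first.
    by rewrite scalerDr linearDl !linearD /= IH IH'.
  rewrite tinterchangeE tmapE /= !contractrE contractlE linearZ /=.
  by rewrite linearZl_LR linearZr_LR /= scalerA.
elim/(@tensor_ind k C D): t => [x y|s t IH IH'].
  by rewrite contractrE linearZ /= tensor_counitE mulrC.
by rewrite !linearD /= IH IH'.
Qed.
Definition hom_fst C D := CoalgHom (hom_fst_subproof C D).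

Lemma hom_snd_subproof C D :
  @coalg_morphism k (tensor_coalgebra C D) D (contractl counit).
Proof.
split=> [a x y|t|t]; first by rewrite linearP.
  elim/(@tensor_ind k C D): t => [x y|s t IH IH']; last first.
    by rewrite !linearD /= IH IH'.
  rewrite contractlE linearZ -{1}(counitl x) /= tensor_comulE.
  move: (comul x) (comul y) => s u.
  elim/(@tensor_ind k C C): s => [c c'|s s' IH IH']; last first.
    by rewrite linearDl !linearD /= scalerDl IH IH'.
  elim/(@tensor_ind k D D): u => [u u'|u u' IH IH']; last first.
    by rewrite scalerDr linearDr !linearD /= IH IH'.
  rewrite tinterchangeE tmapE /= !contractlE linearZ /=.
  by rewrite linearZl_LR linearZr_LR /= scalerA.
elim/(@tensor_ind k C D): t => [x y|s t IH IH'].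
  by rewrite contractlE linearZ /= tensor_counitE.
by rewrite !linearD /= IH IH'.
Qed.
Definition hom_snd C D := CoalgHom (hom_snd_subproof C D).

(** This is the uniqueness half of the universal property of the product; it also
says that the identity of [C ⊗ D] is the pair of its projections. *)
Lemma pair_fst_snd C D (t : tensor_coalgebra C D) :
  pair_fun (hom_fst C D) (hom_snd C D) t = t.
Proof.
rewrite /pair_fun /=; elim/(@tensor_ind k C D): t => [x y|s t IH IH'].
  rewrite tensor_comulE -{2}(counitr x) -{2}(counitl y).
  move: (comul x) (comul y) => s u.
  elim/(@tensor_ind k C C): s => [c c'|s s' IH IH']; last first.
    by rewrite linearDl !linearD linearDl /= IH IH'.
  elim/(@tensor_ind k D D): u => [u u'|u u' IH IH']; last first.
    by rewrite linearDr !linearD linearDr /= IH IH'.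
  rewrite tinterchangeE tmapE /= !contractrE !contractlE.
  by rewrite !(linearZl_LR, linearZr_LR) /= !scalerA mulrC.
by rewrite !linearD /= IH IH'.
Qed.

Lemma hom_fst_pair C D E cC (f : coalg_hom C D) (g : coalg_hom C E) :
  hom_comp (hom_fst D E) (hom_pair cC f g) = f.
Proof.
by apply: hom_ext => x; rewrite /= contractr_pair // => y; rewrite hom_counit.
Qed.

Lemma hom_snd_pair C D E cC (f : coalg_hom C D) (g : coalg_hom C E) :
  hom_comp (hom_snd D E) (hom_pair cC f g) = g.
Proof.
by apply: hom_ext => x; rewrite /= contractl_pair // => y; rewrite hom_counit.
Qed.

Lemma hom_pair_comp B C D E cB cC (f : coalg_hom C D) (g : coalg_hom C E)
    (h : coalg_hom B C) :
  hom_comp (hom_pair cC f g) h = hom_pair cB (hom_comp f h) (hom_comp g h).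
Proof. by apply: hom_ext => x; rewrite /= pair_hom. Qed.

Lemma cocommutative_tensor C D :
  cocommutative C -> cocommutative D -> cocommutative (tensor_coalgebra C D).
Proof.
move=> cC cD t; rewrite /=.
elim/(@tensor_ind k C D): t => [x y|s t IH IH'].
  rewrite tensor_comulE -{2}cC -{2}cD.
  move: (comul x) (comul y) => s u.
  elim/(@tensor_ind k C C): s => [c c'|s s' IH IH']; last first.
    by rewrite linearDl !linearD linearDl linearD /= IH IH'.
  elim/(@tensor_ind k D D): u => [u u'|u u' IH IH']; last first.
    by rewrite linearDr !linearD linearDr linearD /= IH IH'.
  by rewrite !tswapE !tinterchangeE tswapE.
by rewrite !linearD /= IH IH'.
Qed.

Lemma coalg_morphism_inverse C D (f : coalg_hom C D) (g : {linear D -> C}) :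
  cancel f g -> cancel g f -> coalg_morphism g.
Proof.
move=> fK gK; split=> [a x y|y|y]; first by rewrite linearP.
  rewrite -[in RHS](gK y) -[RHS]/(pair_fun g g _) pair_hom.
  rewrite -[LHS]tmap_id.
  change (pair_fun idfun idfun (g y) = pair_fun (g \o f) (g \o f) (g y)).
  by apply: eq_pair => z; rewrite /= fK.
by rewrite -(hom_counit f) gK.
Qed.

End HomCategory.

(** * Convolution and the group of points of a Hopf algebra *)

Section Convolution.
Context {k : fieldType} {A : coalgebra k} (H : hopf_algebra A).

Definition tmul : A ⊗ A -> A := tlift (hmul H).

Lemma hmul_bilin : bilinear_for *:%R *:%R (hmul H).
Proof. by split=> [y|x] a u v /=; rewrite ?linearPl ?linearPr. Qed.

HB.instance Definition _ :=
  GRing.isLinear.Build k _ _ _ tmul (tlift_linear hmul_bilin).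

Lemma tmulE a b : tmul (a ⊗ b) = a *[H] b.
Proof. exact: tliftE hmul_bilin. Qed.

(** The compatibility of a bialgebra, read as a property of the multiplication. *)
Lemma tmul_hom_subproof : @coalg_morphism k (tensor_coalgebra A A) A tmul.
Proof.
split=> [c s t|t|t]; first by rewrite linearP.
  elim/(@tensor_ind k A A): t => [a b|s t IH IH']; last first.
    by rewrite !linearD /= IH IH'.
  rewrite tmulE comulM /= tensor_comulE.
  pose F s t : A ⊗ A := tmap tmul tmul (tinterchange (s ⊗ t)).
  have -> : (fun a1 a2 : A => \sw_(b1, b2 <- b)
        ((a1 *[H] b1) ⊗ (a2 *[H] b2))) = fun a1 a2 => F (a1 ⊗ a2) (comul b).
    apply/funext=> a1; apply/funext=> a2; rewrite -[RHS]tlift_pure.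
      by congr tlift; apply/funext=> b1; apply/funext=> b2;
        rewrite /F tinterchangeE tmapE /= !tmulE.
    by move=> c s t; rewrite /F linearPr !linearP.
  rewrite -[RHS]/(F (comul a) (comul b)).
  apply: (tlift_pure (f := F^~ (comul b))) => c s t.
  by rewrite /F linearPl !linearP.
elim/(@tensor_ind k A A): t => [a b|s t IH IH']; last first.
  by rewrite !linearD /= IH IH'.
by rewrite tmulE counitM /= tensor_counitE.
Qed.
Definition mul_hom := CoalgHom tmul_hom_subproof.

Section Conv.
Context {C : coalgebra k}.

Definition conv (f g : C -> A) : C -> A := tmul \o pair_fun f g.
HB.instance Definition _ (f g : {linear C -> A}) :=
  GRing.Linear.on (conv f g).

Definition conv1 (x : C) : A := counit x *: hone H.

Lemma conv1_linear : linear conv1.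
Proof. by move=> a x y; rewrite /conv1 linearP /= scalerDl scalerA. Qed.
HB.instance Definition _ := GRing.isLinear.Build k C A _ conv1 conv1_linear.

(** The maps into [A] are kept merely linear here, because the antipode is not
known to be a coalgebra morphism before [antipode_hom_subproof]. *)
Lemma convA (f g h : {linear C -> A}) :
  conv (conv f g) h =1 conv f (conv g h).
Proof.
move=> x.
rewrite -[LHS]/(tmul (pair_fun (tmul \o pair_fun f g) (idfun \o h) x)).
rewrite -[RHS]/(tmul (pair_fun (idfun \o f) (tmul \o pair_fun g h) x)).
rewrite -!tmap_pair -pair_assoc.
elim/(@tensor_ind3 k A A A): (pair_fun _ _ x) => [a b c|s t IH IH'].
  by rewrite tassocE !tmapE /= !tmulE hmulA.
by rewrite !linearD /= IH IH'.
Qed.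

Lemma conv1f (f : {linear C -> A}) : conv conv1 f =1 f.
Proof.
move=> x; rewrite -{2}(counitl x) /conv /pair_fun /=.
elim/(@tensor_ind k C C): (comul x) => [u v|s t IH IH'].
  by rewrite tmapE contractlE /= tmulE /conv1 linearZ linearZl_LR /= hmul1l.
by rewrite !linearD /= IH IH'.
Qed.

Lemma convf1 (f : {linear C -> A}) : conv f conv1 =1 f.
Proof.
move=> x; rewrite -{2}(counitr x) /conv /pair_fun /=.
elim/(@tensor_ind k C C): (comul x) => [u v|s t IH IH'].
  by rewrite tmapE contractrE /= tmulE /conv1 [RHS]linearZ linearZr_LR /= hmul1r.
by rewrite !linearD /= IH IH'.
Qed.

Lemma eq_conv (f f' g g' : C -> A) :
  f =1 f' -> g =1 g' -> conv f g =1 conv f' g'.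
Proof. by move=> /funext -> /funext ->. Qed.

End Conv.

Lemma conv_hom (C D : coalgebra k) (f : coalg_hom C D)
    (u v : {linear D -> A}) x :
  conv u v (f x) = conv (u \o f) (v \o f) x.
Proof. by rewrite /conv /= pair_hom. Qed.

Lemma convVl : conv (antipode H) idfun =1 conv1.
Proof.
move=> x; rewrite /conv1 -antipodel /conv /pair_fun /=.
rewrite -[LHS](tlift_pure (f := tmul \o tmap (antipode H) idfun)); last first.
  by move=> a s t; rewrite linearP.
by congr tlift; apply/funext=> a; apply/funext=> b; rewrite /= tmapE /= tmulE.
Qed.

Lemma convVr : conv idfun (antipode H) =1 conv1.
Proof.
move=> x; rewrite /conv1 -antipoder /conv /pair_fun /=.
rewrite -[LHS](tlift_pure (f := tmul \o tmap idfun (antipode H))); last first.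
  by move=> a s t; rewrite linearP.
by congr tlift; apply/funext=> a; apply/funext=> b; rewrite /= tmapE /= tmulE.
Qed.

Section ConvHom.
Context {C : coalgebra k} (f : coalg_hom C A).
Lemma conv_antipodel : conv (antipode H \o f) f =1 conv1.
Proof.
by move=> x; have := convVl (f x); rewrite conv_hom /conv1 hom_counit.
Qed.
Lemma conv_antipoder : conv f (antipode H \o f) =1 conv1.
Proof.
by move=> x; have := convVr (f x); rewrite conv_hom /conv1 hom_counit.
Qed.
End ConvHom.

Lemma one_hom_subproof C : coalg_morphism (@conv1 C).
Proof.
split=> [a x y|x|x]; first by rewrite linearP.
  rewrite {1}/conv1 linearZ /= comul1 -{1}(counitl x).
  elim/(@tensor_ind k C C): (comul x) => [u v|s t IH IH'].
    rewrite contractlE linearZ tmapE /= /conv1.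
    by rewrite linearZl_LR linearZr_LR /= scalerA.
  by rewrite !linearD /= scalerDl IH IH'.
by rewrite /conv1 linearZ /= counit1 mulr1.
Qed.
Definition one_hom C := CoalgHom (one_hom_subproof C).

(** [shear u (a ⊗ b) = a1 ⊗ u(a2) b]. For [u] the identity this is the morphism
[(fst, mul)], the analogue of [(a, b) |-> (a, a b)] for a group; its inverse is
the shear for the antipode. *)
Definition shear (u : A -> A) : A ⊗ A -> A ⊗ A :=
  tmap idfun (tmul \o tmap u idfun) \o @tassoc k A A A \o tmap comul idfun.
HB.instance Definition _ (u : {linear A -> A}) := GRing.Linear.on (shear u).

Lemma shear_pair C (f : coalg_hom C A) (g : {linear C -> A})
    (u : {linear A -> A}) x :
  shear u (pair_fun f g x) = pair_fun f (conv (u \o f) g) x.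
Proof.
rewrite /shear /= tmap_pair.
have -> : pair_fun (comul \o f) (idfun \o g) x = pair_fun (pair_fun f f) g x.
  by apply: eq_pair => // y; rewrite /= hom_comul.
by rewrite pair_assoc tmap_pair; apply: eq_pair => // y; rewrite /= tmap_pair.
Qed.

Local Notation p1 := (hom_fst A A).
Local Notation p2 := (hom_snd A A).

Lemma shearE (u : {linear A -> A}) t :
  shear u t = pair_fun p1 (conv (u \o p1) p2) t.
Proof. by rewrite -shear_pair pair_fst_snd. Qed.

(** On pairs [shear u] acts by left convolution with [u] in the second component,
so that convolution-inverse [u] and [v] give inverse shears. *)
Lemma shearK (u v : {linear A -> A}) :
  conv v u =1 conv1 -> cancel (shear u) (shear v).
Proof.
move=> vu t; rewrite (shearE u) shear_pair -[RHS]pair_fst_snd.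
apply: eq_pair => // s; rewrite -convA -[RHS]conv1f.
apply: eq_conv => // r.
by rewrite -[LHS]conv_hom vu /conv1 hom_counit.
Qed.

Section Cocommutative.
Context (cA : cocommutative A).
Let cAA : cocommutative (tensor_coalgebra A A) := cocommutative_tensor cA cA.

(** The shear for the identity is a coalgebra morphism, being the pairing of two
morphisms, hence so is its inverse, the shear for the antipode. The antipode is
recovered from the latter as the composite [a |-> a ⊗ 1 |-> a1 ⊗ S(a2) |-> S(a)]
of morphisms. *)
Lemma antipode_hom_subproof : coalg_morphism (antipode H).
Proof.
pose Phi := hom_pair cAA p1 mul_hom.
have PhiE t : Phi t = shear idfun t.
  rewrite shearE; apply: eq_pair => // s.
  by rewrite /= /conv /= -[in LHS](pair_fst_snd s).
have PsiP : @coalg_morphism k (tensor_coalgebra A A) (tensor_coalgebra A A)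
    (shear (antipode H)).
  apply: (@coalg_morphism_inverse k _ _ Phi) => t; rewrite PhiE.
    exact: (shearK convVl).
  exact: (shearK convVr).
pose S' := hom_comp p2
  (hom_comp (CoalgHom PsiP) (hom_pair cA (hom_id A) (one_hom A))).
suff -> : antipode H = S' :> (A -> A) by exact: homP.
apply/funext => x.
rewrite -[RHS]/(contractl counit (shear (antipode H)
  (pair_fun (hom_id A) (one_hom A) x))).
rewrite shear_pair contractl_pair //.
by rewrite -[LHS](convf1 (antipode H)).
Qed.
Definition antipode_hom := CoalgHom antipode_hom_subproof.

Section Points.
Context (C : coalgebra k) (cC : cocommutative C).

Definition point_mul (f g : coalg_hom C A) :=
  hom_comp mul_hom (hom_pair cC f g).
Definition point_inv (f : coalg_hom C A) := hom_comp antipode_hom f.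

Lemma point_mulA : associative point_mul.
Proof.
move=> f g h; apply: hom_ext => x.
by rewrite -[LHS]/(conv f (conv g h) x) -convA.
Qed.

Lemma point_mul1l : left_id (one_hom C) point_mul.
Proof. by move=> f; apply: hom_ext => x; exact: (conv1f f). Qed.
Lemma point_mul1r : right_id (one_hom C) point_mul.
Proof. by move=> f; apply: hom_ext => x; exact: (convf1 f). Qed.
Lemma point_mulVl : left_inverse (one_hom C) point_inv point_mul.
Proof. by move=> f; apply: hom_ext => x; exact: (conv_antipodel f). Qed.
Lemma point_mulVr : right_inverse (one_hom C) point_inv point_mul.
Proof. by move=> f; apply: hom_ext => x; exact: (conv_antipoder f). Qed.

Definition point_group : group_law (coalg_hom C A) :=
  GroupLaw point_mulA point_mul1l point_mul1r point_mulVl point_mulVr.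
End Points.

(** Precomposition with a coalgebra morphism is a homomorphism of groups of
points. *)
Lemma point_mul_comp B C (cB : cocommutative B) (cC : cocommutative C)
    (f g : coalg_hom C A) (h : coalg_hom B C) :
  hom_comp (point_mul cC f g) h = point_mul cB (hom_comp f h) (hom_comp g h).
Proof. by rewrite /point_mul -(hom_pair_comp cB cC); apply: hom_ext. Qed.

Lemma point_inv_comp B C (f : coalg_hom C A) (h : coalg_hom B C) :
  hom_comp (point_inv f) h = point_inv (hom_comp f h).
Proof. exact: hom_ext. Qed.
End Cocommutative.

End Convolution.

(** * The skew brace of points of a Hopf brace *)

Section Brace.
Context {k : fieldType} (A : hopf_brace k).
Local Notation dot := (@dot k A).
Local Notation circ := (@circ k A).

(** [brace_rhs] sends [((a1 ⊗ b) ⊗ a2) ⊗ (a3 ⊗ c)] to the right-hand side of the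
brace axiom, with the factors in the order in which they occur there;
[brace_shuffle] brings [(a1 ⊗ (a2 ⊗ a3)) ⊗ (b ⊗ c)] into that order. *)
Definition brace_rhs : (A ⊗ A ⊗ A) ⊗ (A ⊗ A) -> A :=
  tmul dot \o tmap (tmul dot \o tmap (tmul circ) (antipode dot)) (tmul circ).
HB.instance Definition _ := GRing.Linear.on brace_rhs.

Definition brace_shuffle : (A ⊗ (A ⊗ A)) ⊗ (A ⊗ A) -> (A ⊗ A ⊗ A) ⊗ (A ⊗ A) :=
  tmap (@trswap k A A A) idfun \o @tinterchange k _ _ _ _
    \o tmap (@tassoc_inv k A A A) idfun.
HB.instance Definition _ := GRing.Linear.on brace_shuffle.

Lemma brace_rhsE a1 a2 a3 b c :
  brace_rhs (brace_shuffle ((a1 ⊗ (a2 ⊗ a3)) ⊗ (b ⊗ c))) =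
  ((a1 *[circ] b) *[dot] antipode dot a2) *[dot] (a3 *[circ] c).
Proof.
rewrite /brace_shuffle /= tmapE /= tassoc_invE tinterchangeE tmapE /= trswapE.
by rewrite /brace_rhs /= tmapE /= tmapE /= !tmulE.
Qed.

Lemma brace_tensor a b c :
  a *[circ] (b *[dot] c) =
  brace_rhs (brace_shuffle (tmap idfun comul (comul a) ⊗ (b ⊗ c))).
Proof.
pose F s := brace_rhs (brace_shuffle (s ⊗ (b ⊗ c))).
have lF : linear F by move=> r s t; rewrite /F linearPl !linearP.
rewrite braceP -[RHS]/((F \o tmap idfun comul) (comul a)).
rewrite -[RHS]tlift_pure; last by move=> r s t; rewrite /= linearP lF.
congr tlift; apply/funext=> a1; apply/funext=> a'; rewrite /= tmapE /=.
rewrite -[RHS]/((F \o pure_tensor a1) (comul a')).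
rewrite -[RHS]tlift_pure; last by move=> r s t; rewrite /= linearPr lF.
by congr tlift; apply/funext=> a2; apply/funext=> a3; rewrite /= /F brace_rhsE.
Qed.

Context (cA : cocommutative A).

Section Points.
Context (C : coalgebra k) (cC : cocommutative C).

(** The brace axiom evaluated at [f x1], [g x2], [h x3]. As [f] is a morphism, the
comultiplication of [f x1] is spread over further Sweedler components of [x], and
by cocommutativity these can be shuffled among those that go to [g] and [h]. *)
Lemma point_braceP (f g h : coalg_hom C A) :
  point_mul circ cC f (point_mul dot cC g h) =
  point_mul dot cC (point_mul dot cC (point_mul circ cC f g)
    (point_inv dot cA f)) (point_mul circ cC f h).
Proof.
apply: hom_ext => x.
rewrite -[LHS]/(tmul circ (pair_fun (idfun \o f) (tmul dot \o pair_fun g h) x)).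
rewrite -tmap_pair.
have -> t : tmul circ (tmap idfun (tmul dot) t) = brace_rhs
    (brace_shuffle (tmap (tmap idfun comul \o comul) idfun t)).
  elim/(@tensor_ind k A (A ⊗ A)%type): t => [a t|s t IH IH']; last first.
    by rewrite !linearD /= IH IH'.
  elim/(@tensor_ind k A A): t => [b c|s t IH IH']; last first.
    by rewrite linearDr !linearD /= IH IH'.
  by rewrite !tmapE /= tmulE tmulE brace_tensor.
rewrite tmap_pair /brace_shuffle /=.
have -> : pair_fun ((tmap idfun comul \o comul) \o f)
      (idfun \o pair_fun g h) x =
    pair_fun (pair_fun f (pair_fun f f)) (pair_fun g h) x.
  apply: eq_pair => // y /=; rewrite hom_comul tmap_pair.
  by apply: eq_pair => // z; rewrite /= hom_comul.
rewrite tmap_pair.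
have -> : pair_fun (@tassoc_inv k A A A \o pair_fun f (pair_fun f f))
      (idfun \o pair_fun g h) x =
    pair_fun (pair_fun (pair_fun f f) f) (pair_fun g h) x.
  by apply: eq_pair => // y; rewrite /= pair_assoc_inv.
rewrite pair_interchange // tmap_pair.
have -> : pair_fun (@trswap k A A A \o pair_fun (pair_fun f f) g)
      (idfun \o pair_fun f h) x =
    pair_fun (pair_fun (pair_fun f g) f) (pair_fun f h) x.
  by apply: eq_pair => // y; rewrite /= pair_rswap.
rewrite /brace_rhs /= tmap_pair.
congr (tmul dot _); apply: eq_pair => // y.
by rewrite /= tmap_pair.
Qed.

Definition point_brace : skew_brace :=
  @SkewBrace (coalg_hom C A) (point_group dot cA cC) (point_group circ cA cC)
    point_braceP.

End Points.

Lemma point_right_comp B C cB cC (f g : @point_brace C cC) (h : coalg_hom B C) :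
  hom_comp (sb_right f g) h =
  sb_right (hom_comp f h : @point_brace B cB) (hom_comp g h).
Proof. by rewrite /sb_right /= !(point_mul_comp _ cB) point_inv_comp. Qed.

Lemma point_left_comp B C cB cC (f g : @point_brace C cC) (h : coalg_hom B C) :
  hom_comp (sb_left f g) h =
  sb_left (hom_comp f h : @point_brace B cB) (hom_comp g h).
Proof.
by rewrite /sb_left /= !(point_mul_comp _ cB) point_inv_comp point_right_comp.
Qed.

Let AA := tensor_coalgebra A A.
Let cAA : cocommutative AA := cocommutative_tensor cA cA.
Let p1 : point_brace cAA := hom_fst A A.
Let p2 : point_brace cAA := hom_snd A A.

Definition hom_of_points (C : coalgebra k) (cC : cocommutative C)
    (p : point_brace cC * point_brace cC) : coalg_hom C AA :=
  hom_pair cC p.1 p.2.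

Definition braiding_hom : coalg_hom AA AA := hom_of_points (sb_r (p1, p2)).
Definition braiding_inv_hom : coalg_hom AA AA :=
  hom_of_points (sb_rinv (p1, p2)).

(** Naturality: the value of [braiding_hom] on a pair of points is determined by
its value on the universal pair [(p1, p2)]. *)
Lemma braiding_hom_point C (cC : cocommutative C)
    (p : point_brace cC * point_brace cC) :
  hom_comp braiding_hom (hom_of_points p) = hom_of_points (sb_r p).
Proof.
case: p => f g; rewrite /braiding_hom /hom_of_points (hom_pair_comp cC) /=.
by rewrite (point_right_comp cC) (point_left_comp cC) hom_fst_pair hom_snd_pair.
Qed.

Lemma braiding_inv_hom_point C (cC : cocommutative C)
    (p : point_brace cC * point_brace cC) :
  hom_comp braiding_inv_hom (hom_of_points p) = hom_of_points (sb_rinv p).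
Proof.
case: p => f g; rewrite /braiding_inv_hom /hom_of_points (hom_pair_comp cC) /=.
rewrite !(point_mul_comp _ cC) !point_inv_comp !(point_mul_comp _ cC).
by rewrite !point_inv_comp hom_fst_pair hom_snd_pair.
Qed.

Lemma hom_of_proj : hom_of_points (p1, p2) = hom_id AA.
Proof. by apply: hom_ext => t; exact: pair_fst_snd. Qed.

Lemma braiding_homK : cancel braiding_hom braiding_inv_hom.
Proof.
move=> t; have := braiding_inv_hom_point (sb_r (p1, p2)).
by rewrite sb_rK hom_of_proj => /(congr1 (fun f : coalg_hom _ _ => f t)).
Qed.

Lemma braiding_inv_homK : cancel braiding_inv_hom braiding_hom.
Proof.
move=> t; have := braiding_hom_point (sb_rinv (p1, p2)).
by rewrite sb_rinvK hom_of_proj => /(congr1 (fun f : coalg_hom _ _ => f t)).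
Qed.

Section Braid.
Let A3 := tensor_coalgebra AA A.
Let cA3 : cocommutative A3 := cocommutative_tensor cAA cA.
Let G := point_brace cA3.
Definition hom_of_points3 (t : G * G * G) : coalg_hom A3 A3 :=
  hom_pair cA3 (hom_of_points t.1) t.2.

Lemma braid12_point t x :
  braid12 braiding_hom (hom_of_points3 t x) = hom_of_points3 (sb_r12 t) x.
Proof.
rewrite /braid12 tmap_pair; apply: eq_pair => // y.
by rewrite -[RHS]/(hom_of_points (sb_r t.1) y) -braiding_hom_point.
Qed.

Lemma braid23_point t x :
  braid23 braiding_hom (hom_of_points3 t x) = hom_of_points3 (sb_r23 t) x.
Proof.
case: t => -[f g] h.
rewrite /braid23 /= pair_assoc tmap_pair -pair_assoc_inv.
congr tassoc_inv; apply: eq_pair => // y.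
rewrite -[LHS]/(hom_comp braiding_hom (hom_of_points (g, h)) y).
by rewrite braiding_hom_point.
Qed.

(** The three projections of [A ⊗ A ⊗ A] together form the identity, so that every
element [t] is the value at [t] of a triple of points. *)
Lemma braiding_hom_braid : braid_equation braiding_hom.
Proof.
move=> t.
pose q : G * G * G := (hom_comp (hom_fst A A) (hom_fst AA A),
  hom_comp (hom_snd A A) (hom_fst AA A), hom_snd AA A).
have -> : t = hom_of_points3 q t.
  rewrite -[LHS](@pair_fst_snd k AA A); apply: eq_pair => // s.
  by rewrite -[LHS](@pair_fst_snd k A A) (pair_hom (hom_fst AA A)).
rewrite /comp !(braid12_point, braid23_point).
exact: (congr1 (fun p => hom_of_points3 p t) (sb_braid q)).
Qed.
End Braid.

End Brace.

(** * Sweedler formulas for the braiding *)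

(** The pairing over the coalgebra [C ⊗ D] is the double Sweedler sum in which
[↼] and the braiding are written. *)
Lemma pair_tensor (k : fieldType) (C D : coalgebra k) (V W U : lmodType k)
    (f : {linear (C ⊗ D)%type -> V}) (g : {linear (C ⊗ D)%type -> W})
    (m : {linear (V ⊗ W)%type -> U}) x y :
  m (@pair_fun k (tensor_coalgebra C D) V W f g (x ⊗ y)) =
  \sw_(x1, x2 <- x) \sw_(y1, y2 <- y) m (f (x1 ⊗ y1) ⊗ g (x2 ⊗ y2)).
Proof.
pose F s t := m (tmap f g (@tinterchange k C C D D (s ⊗ t))).
rewrite -[LHS]/(m (tmap f g (tensor_comul (x ⊗ y)))) tensor_comulE.
rewrite -[LHS](tlift_pure (V := C) (W := C) (f := F^~ (comul y))); last first.
  by move=> a s t; rewrite /F linearPl !linearP.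
congr tlift; apply/funext=> x1; apply/funext=> x2.
rewrite -[LHS](tlift_pure (V := D) (W := D) (f := F (x1 ⊗ x2))); last first.
  by move=> a s t; rewrite /F linearPr !linearP.
congr tlift; apply/funext=> y1; apply/funext=> y2.
by rewrite /F tinterchangeE tmapE.
Qed.

(** The identity [x1 ⊗ ε(y1) (x2 ⊗ y2) = x1 ⊗ (x2 ⊗ y)], for arbitrary tensors in
place of the two comultiplications. *)
Lemma tmap_fst_interchange (k : fieldType) (C D : coalgebra k)
    (s : C ⊗ C) (u : D ⊗ D) :
  tmap (contractr counit) idfun (tinterchange (s ⊗ u)) =
  tassoc (s ⊗ contractl counit u).
Proof.
elim/(@tensor_ind k C C): s => [c c'|s s' IH IH']; last first.
  by rewrite !linearDl !linearD /= IH IH'.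
elim/(@tensor_ind k D D): u => [d d'|u u' IH IH']; last first.
  by rewrite linearDr !linearD linearDr linearD /= IH IH'.
rewrite tinterchangeE tmapE /= contractrE contractlE linearZl_LR linearZr_LR.
by rewrite linearZ /= tassocE.
Qed.

Section Sweedler.
Context (k : fieldType) (A : hopf_brace k) (cA : cocommutative A).
Local Notation AA := (tensor_coalgebra A A).
Let cAA : cocommutative AA := cocommutative_tensor cA cA.
Let p1 : point_brace cA cAA := hom_fst A A.
Let p2 : point_brace cA cAA := hom_snd A A.

Lemma tmul_fst_snd (H : hopf_algebra A) t : point_mul H cAA p1 p2 t = tmul H t.
Proof. by rewrite /= pair_fst_snd. Qed.

Lemma harpoon_rightE x y : sb_right p1 p2 (x ⊗ y) = x ⇀ y.
Proof.
pose F s := tmul dot (tmap (antipode dot) (tmul circ) (tassoc (s ⊗ y))).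
transitivity (F (comul x)).
  rewrite -[LHS]/(tmul dot
    (pair_fun (antipode dot \o p1) (point_mul circ cAA p1 p2) (x ⊗ y))).
  have -> : pair_fun (antipode dot \o p1) (point_mul circ cAA p1 p2) (x ⊗ y) =
      pair_fun (antipode dot \o p1) (tmul circ \o idfun) (x ⊗ y).
    by apply: eq_pair => // t; exact: tmul_fst_snd.
  rewrite -tmap_pair /pair_fun /= tensor_comulE.
  by rewrite tmap_fst_interchange counitl.
rewrite -[LHS]tlift_pure; last by move=> a s t; rewrite /F linearPl !linearP.
congr tlift; apply/funext=> a; apply/funext=> b.
by rewrite /F tassocE tmapE /= !tmulE.
Qed.

Lemma harpoon_leftE x y : sb_left p1 p2 (x ⊗ y) = x ↼ y.
Proof.
rewrite -[LHS]/(tmul circ (@pair_fun k AA A A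
  (antipode circ \o (sb_right p1 p2 : coalg_hom AA A))
  (point_mul circ cAA p1 p2) (x ⊗ y))).
rewrite pair_tensor; congr tlift; apply/funext=> x1; apply/funext=> x2.
congr tlift; apply/funext=> y1; apply/funext=> y2.
rewrite -[LHS]/(tmul circ (antipode circ (sb_right p1 p2 (x1 ⊗ y1)) ⊗
  point_mul circ cAA p1 p2 (x2 ⊗ y2))).
by rewrite harpoon_rightE tmul_fst_snd !tmulE hmulA.
Qed.

Lemma braiding_pureE x y : braiding_hom cA (x ⊗ y) = braiding_pure x y.
Proof.
rewrite -[LHS]/(idfun (@pair_fun k AA A A (sb_right p1 p2 : coalg_hom AA A)
  (sb_left p1 p2 : coalg_hom AA A) (x ⊗ y))).
rewrite pair_tensor; congr tlift; apply/funext=> x1; apply/funext=> x2.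
congr tlift; apply/funext=> y1; apply/funext=> y2.
by rewrite -harpoon_rightE -harpoon_leftE.
Qed.

Lemma braidingE : @braiding k A = braiding_hom cA.
Proof.
apply/funext=> t; rewrite -[RHS](tlift_pure (V := A) (W := A)).
  by congr tlift; apply/funext=> x; apply/funext=> y; rewrite braiding_pureE.
by move=> a s u; rewrite linearP.
Qed.
End Sweedler.

Theorem corollary2p4 (k : fieldType) (A : hopf_brace k)
    (A_cocomm : cocommutative A) :
  [/\ forall x y : A, braiding (x ⊗ y) =
        \sw_(x1, x2 <- x) \sw_(y1, y2 <- y) ((x1 ⇀ y1) ⊗ (x2 ↼ y2)),
      @coalg_isomorphism k (tensor_coalgebra A A) (tensor_coalgebra A A)
        (@braiding k A)
    & braid_equation (@braiding k A)].
Proof.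
rewrite (braidingE A_cocomm); split; first exact: braiding_pureE.
  split; first exact: homP.
  exists (braiding_inv_hom A_cocomm); split; first exact: homP.
    exact: braiding_homK.
  exact: braiding_inv_homK.
exact: braiding_hom_braid.
Qed.
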